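(* Let $\Bbbk$ be a field of characteristic zero, let $A_1,\dots,A_n$ be finite subsets of $\Bbbk$, let $\nu_i:A_i\to\mathbb{N}$ ($i=1,\dots,n$) be functions with positive integer values, put $\mathbf{A}=A_1\times\cdots\times A_n$, and let $H_i(x_i)=\prod_{a\in A_i}(x_i-a)^{\nu_i(a)}\in\Bbbk[x_i]$. Let $g\in\Bbbk[x_1,\dots,x_n]$ be any polynomial. Define $r_0:=g$ and, successively for $i=1,\dots,n$, let $q_i,r_i\in\Bbbk[x_1,\dots,x_n]$ be the unique quotient and remainder of the Euclidean division of $r_{i-1}$ by $H_i$ with respect to the variable $x_i$, i.e. $r_{i-1}=H_iq_i+r_i$ with $\deg_ir_i<\deg H_i$. Then the unique polynomial $f\in V(\mathbf{A},\nu)$ satisfying $\partial_{\mathbf{a}}^{\mathbf{m}}f=\partial_{\mathbf{a}}^{\mathbf{m}}g$ for all $\mathbf{a}\in\mathbf{A}$ and $\mathbf{m}\in[\mathbf{0},\nu(\mathbf{a})-\mathbf{1}]$ is equal to $r_n$, and the remainder of the interpolation is $$g-f=\sum_{i=1}^nH_iq_i.$$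
   Context: For $\mathbf{a}=(a_1,\dots,a_n)\in\mathbf{A}$, $\nu(\mathbf{a}):=(\nu_1(a_1),\dots,\nu_n(a_n))$, and $[\mathbf{0},\nu(\mathbf{a})-\mathbf{1}]$ is the set of $\mathbf{k}=(k_1,\dots,k_n)$ with integers $0\le k_i\le\nu_i(a_i)-1$. $\partial_{\mathbf{a}}^{\mathbf{k}}f$ is the value at $\mathbf{x}=\mathbf{a}$ of the formal partial derivative $\frac{\partial^{k_1+\cdots+k_n}f}{\partial x_1^{k_1}\cdots\partial x_n^{k_n}}$. $\deg_i$ is the degree in the variable $x_i$ (the zero polynomial has degree $-\infty$). $V(\mathbf{A},\nu)$ is the $\Bbbk$-vector space of all $f\in\Bbbk[x_1,\dots,x_n]$ with $\deg_i f<\sum_{a\in A_i}\nu_i(a)$ for $i=1,\dots,n$. *)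

(* Defs.v *)
From HB Require Import structures.
From mathcomp Require Import all_boot all_algebra.
From mathcomp Require Import finmap.
From mathcomp Require Export mpoly.

Set Implicit Arguments.
Unset Strict Implicit.
Unset Printing Implicit Defensive.

Import GRing.Theory.
Local Open Scope ring_scope.

Section CoordinateMeasure.
Context (n : nat) (i : 'I_n).

Definition mnm_at (m : 'X_{1..n}) : nat := m i.

Fact mnm_at0 : mnm_at 0%MM = 0%N.
Proof. exact: mnm0E. Qed.

Fact mnm_atD : {morph mnm_at : m1 m2 / (m1 + m2)%MM >-> (m1 + m2)%N}.
Proof. by move=> m1 m2; exact: mnmDE. Qed.

HB.instance Definition _ := isMeasure.Build n mnm_at mnm_at0 mnm_atD.
End CoordinateMeasure.

Section Hermite.
Context (K : fieldType) (n : nat).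
Implicit Types (f g p q r : {mpoly K[n]}) (i : 'I_n) (m : 'X_{1..n}).

(* As with [size] and [msize], this is 1 + deg_i f, and 0 when f = 0; so       *)
(* deg_i f < d reads [msize_in i f <= d].                                      *)
Definition msize_in i f : nat := mmeasure (mnm_at i) f.

Definition mpoly_of_poly i (h : {poly K}) : {mpoly K[n]} := horner_alg 'X_i h.

Lemma msize_in_leP i f (d : nat) :
  reflect (forall m, m \in msupp f -> (m i < d)%N) (msize_in i f <= d)%N.
Proof.
rewrite /msize_in mmeasureE; apply: (iffP idP) => [|fd].
  by move=> /bigmax_leqP_seq + m mf => /(_ m mf isT).
by apply/bigmax_leqP_seq => m /fd.
Qed.

(* nu i stands for a function on A i; its values off A i never matter, since  *)
(* [in_box a] is only used for a in the grid.                                 *)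
Context (A : 'I_n -> {fset K}) (nu : 'I_n -> K -> nat).

Definition Hpoly i : {poly K} := \prod_(a <- A i) ('X - a%:P) ^+ nu i a.

Lemma mpoly_of_HpolyE i :
  mpoly_of_poly i (Hpoly i) = \prod_(a <- A i) ('X_i - a%:MP) ^+ nu i a.
Proof.
rewrite /mpoly_of_poly /Hpoly rmorph_prod; apply: eq_bigr => a _.
by rewrite rmorphXn rmorphB /= horner_algX horner_algC alg_mpolyC.
Qed.

Definition in_grid (a : 'I_n -> K) : Prop := forall i, a i \in A i.

Definition in_box (a : 'I_n -> K) m : Prop :=
  forall i, (m i <= nu i (a i) - 1)%N.

Definition Vspace : {pred {mpoly K[n]}} :=
  [pred f | [forall i, msize_in i f <= \sum_(a <- A i) nu i a]]%N.

Lemma Vspace_submod_closed : submod_closed Vspace.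
Proof.
split=> [|c f g /forallP fV /forallP gV]; apply/forallP => i.
  by rewrite /msize_in mmeasure0.
apply: leq_trans (mmeasureD_le _ _ _) _; rewrite geq_max gV andbT.
exact: leq_trans (mmeasureZ_le _ _ _) (fV i).
Qed.

HB.instance Definition _ :=
  GRing.isSubmodClosed.Build K {mpoly K[n]} Vspace Vspace_submod_closed.

Definition partial_at (a : 'I_n -> K) m f : K := (f^`M[m]).@[a].

Definition interpolates g f : Prop :=
  f \in Vspace /\
  forall a m, in_grid a -> in_box a m -> partial_at a m f = partial_at a m g.

(* deg_i r < deg h, in terms of sizes: both sides are shifted by one. *)
Definition is_edivp_in i p (h : {poly K}) q r : Prop :=
  p = mpoly_of_poly i h * q + r /\ (msize_in i r < size h)%N.

End Hermite.

(* Main.v *)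
Require Import Defs.
From HB Require Import structures.
From mathcomp Require Import all_boot all_algebra.
From mathcomp Require Import finmap ssrcomplements ring zify.
Set Implicit Arguments.
Unset Strict Implicit.
Unset Printing Implicit Defensive.
Import GRing.Theory.
Local Open Scope ring_scope.

(* Identify K[x_1, ..., x_n] with the tensor power of the univariate ring.     *)
(* Division by H_i in the variable x_i and the functionals f |-> d_a^k f are   *)
(* both tensor products of univariate linear maps: u |-> u %% H_i (with the    *)
(* identity in the other variables), respectively u |-> u^(k_i)(a_i).          *)
(* Multiples of H_i are killed by each of them, so r_n interpolates g, and     *)
(* reduction in one variable does not raise the degree in the others, so r_n   *)
(* lies in V. For uniqueness, in characteristic zero the univariate remainder  *)
(* u %% H_i is a combination \sum_(a, k) u^(k)(a) L_(a, k) with L independent  *)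
(* of u; hence trading, one variable at a time, reduction for jets shows that  *)
(* a polynomial with vanishing jets has total reduction 0, while an element of *)
(* V is its own total reduction.                                               *)

(** The formula for g - r_n is the telescoping sum of r_(i-1) - r_i = H_i q_i. [tensor_mul_eq0]
    kills the multiples of H_i, under remainders as under jets; [is_edivp_in_tensor] shows that
    every division remainder is a tensor, hence unique. [hermite_basis], carried to several
    variables by [tensor_expand] and iterated in [tensor_jet_mod_eq0], gives uniqueness of the
    interpolant. *)

Section Univariate.
Context (K : fieldType).
Implicit Types (p : {poly K}) (a b : K) (s : seq K).

Lemma derivn_horner_eq0 a (e k : nat) p :
  (k < e)%N -> ('X - a%:P) ^+ e %| p -> p^`(k).[a] = 0.
Proof.
elim: k e p => [|k IHk] [//|e] p ke /dvdpP[q ->].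
  by rewrite derivn0 hornerM exprS hornerM hornerXsubC subrr mul0r mulr0.
rewrite derivSn (IHk e) // derivM deriv_exp /= exprS mulrA dvdp_add ?dvdp_mull//.
by rewrite -mulr_natr -mulrA mulrC -mulrA dvdp_mulr// dvdp_mull.
Qed.

Lemma dvdp_taylor p a (e : nat) :
  ('X - a%:P) ^+ e %| p - \sum_(k < e) p^`N(k).[a] *: ('X - a%:P) ^+ k.
Proof.
(* Expand [p] at X = a + (X - a) over the ring of polynomials; [e + size p] terms let the sum split
   at [e]. *)
have := nderiv_taylor_wide (mulrC a%:P ('X - a%:P)).
move=> /(_ (e + size p)%N p^:P); rewrite size_map_polyC leq_addl => /(_ isT).
rewrite [a%:P + _]addrC subrK -[p^:P.['X]]/(p \Po 'X) comp_polyXr => {1}->.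
under eq_bigr do rewrite nderivn_map horner_map mul_polyC.
rewrite big_split_ord /= addrAC subrr add0r.
apply: (big_ind (fun q => ('X - a%:P) ^+ e %| q)) => [|q1 q2|k _].
- exact: dvdp0.
- exact: dvdp_add.
by rewrite exprD -mul_polyC mulrCA dvdp_mulr.
Qed.

Hypothesis charK0 : [pchar K] =i pred0.

Lemma hermite_basis (nu : K -> nat) s : uniq s ->
  exists L : K -> nat -> {poly K}, forall p,
    \prod_(a <- s) ('X - a%:P) ^+ nu a %|
      p - \sum_(a <- s) \sum_(k < nu a) p^`(k).[a] *: L a k.
Proof.
elim: s => [_|b s IHs /andP[bs us]].
  by exists (fun _ _ => 0) => p; rewrite big_nil dvd1p.
have {IHs us}[L dvdL] := IHs us.
set H := \prod_(a <- s) ('X - a%:P) ^+ nu a in dvdL.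
set D := ('X - b%:P) ^+ nu b.
(* Glue the basis for [s] to the Taylor expansion at [b] by the Chinese        *)
(* remainder theorem.                                                          *)
have : coprimep D H.
  rewrite coprimep_expl // coprimep_sym /H.
  rewrite coprimep_XsubC rootE horner_prod prodf_seq_neq0.
  apply/allP => a sa /=; rewrite horner_exp hornerXsubC expf_neq0// subr_eq0.
  by apply: contraNneq bs => ->.
move=> /Bezout_eq1_coprimepP[[u v] /= uv1].
(* By Bezout, [v * H] is 1 modulo [D] and 0 modulo [H], and [u * D] the reverse. *)
exists (fun a k => if a == b then v * H * (k`!%:R^-1 *: ('X - b%:P) ^+ k)
                   else u * D * L a k) => p.
rewrite !big_cons eqxx -/D -/H.
under [X in _ - (X + _)]eq_bigr do rewrite scalerAr scalerA nderivn_def hornerMn.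
rewrite -mulr_sumr.
have -> : \sum_(a <- s) \sum_(k < nu a) p^`(k).[a] *:
    (if a == b then v * H * (k`!%:R^-1 *: ('X - b%:P) ^+ k)
                    else u * D * L a k)
    = u * D * \sum_(a <- s) \sum_(k < nu a) p^`(k).[a] *: L a k.
  rewrite mulr_sumr; apply: eq_big_seq => a sa; rewrite mulr_sumr.
  apply: eq_bigr => k _; rewrite ifN ?scalerAr//.
  by apply: contraNneq bs => <-.
set S := \sum_(a <- s) _; set T := \sum_(k < _) _.
have -> : p - (v * H * T + u * D * S) = u * D * (p - S) + v * H * (p - T).
  by rewrite -[p in LHS]mul1r -uv1; ring.
rewrite dvdp_add//; first by rewrite -mulrA dvdp_mull// dvdp_mul.
rewrite -mulrA dvdp_mull// mulrC dvdp_mul//.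
suff -> : T = \sum_(k < nu b) p^`N(k).[b] *: ('X - b%:P) ^+ k.
  exact: dvdp_taylor.
(* Characteristic zero makes [k!] invertible. *)
apply: eq_bigr => k _; rewrite -mulr_natr mulfK//.
by rewrite (pcharf0P K).1 // -lt0n fact_gt0.
Qed.
End Univariate.

(** * Tensor products of univariate operators *)

Section CoordinatewiseOperators.
Context (K : fieldType) (n : nat).
Implicit Types (f g : {mpoly K[n]}) (i j : 'I_n) (m : 'X_{1..n}) (p h : {poly K}).
Implicit Types T : 'I_n -> {poly K} -> {poly K}.

Local Notation mop := (@mpoly_of_poly K n).

Lemma mpoly_of_polyM i : {morph mop i : p q / p * q}.
Proof. by move=> p q; rewrite /mpoly_of_poly rmorphM. Qed.

Lemma mpoly_of_polyC i c : mop i c%:P = c%:MP.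
Proof. by rewrite /mpoly_of_poly horner_algC alg_mpolyC. Qed.

Lemma mpoly_of_polyXn i k : mop i 'X^k = 'X_i ^+ k.
Proof. by rewrite /mpoly_of_poly rmorphXn /= horner_algX. Qed.

Lemma mpoly_of_polyE i p : mop i p = \sum_(k < size p) p`_k *: 'X_i ^+ k.
Proof.
rewrite -{1}[p]coefK poly_def /mpoly_of_poly raddf_sum /=.
by apply: eq_bigr => k _; rewrite linearZ /= mulr_algl rmorphXn /= horner_algX.
Qed.

Lemma mcoeff_mpoly_of_poly i p k :
  (mop i p)@_(U_(i) *+ k) = p`_k.
Proof.
rewrite mpoly_of_polyE raddf_sum -[in RHS](coefK p) poly_def coef_sum.
apply: eq_bigr => l _; rewrite /= mcoeffZ mpolyXn mcoeffX coefZ coefXn.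
congr (_ * _%:R); congr nat_of_bool.
apply/eqP/eqP => [/mnmP/(_ i)|->//].
by rewrite !mulmnE mnm1E eqxx !mul1n.
Qed.

(* The operator \bigotimes_i T_i acting on K[x_1] \otimes ... \otimes K[x_n];  *)
(* this reading needs every T_i to be linear.                                  *)
Definition tensor T f : {mpoly K[n]} :=
  \sum_(m <- msupp f) f@_m *: \prod_i mop i (T i 'X^(m i)).

Arguments tensor : simpl never.

Lemma tensorwE k T f : (msize f <= k)%N ->
  tensor T f = \sum_(m : 'X_{1..n < k}) f@_m *: \prod_i mop i (T i 'X^(m i)).
Proof.
move=> le_fk; set I : subFinType _ := 'X_{1..n < k}.
rewrite /tensor (big_mksub I) ?msupp_uniq //=; last first.
  by move=> m /msize_mdeg_lt /leq_trans; apply.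
by rewrite big_rmcond //= => m /memN_msupp_eq0 ->; rewrite scale0r.
Qed.

(** No linearity of the [T i] is required: they are evaluated on monomials only. *)
Lemma tensor_is_linear T : linear (tensor T).
Proof.
move=> c f g; set k := maxn (msize (c *: f + g)) (maxn (msize f) (msize g)).
rewrite !(@tensorwE k); try by rewrite !leq_max leqnn ?orbT.
rewrite scaler_sumr -big_split; apply: eq_bigr => m _ /=.
by rewrite scalerA -scalerDl mcoeffD mcoeffZ.
Qed.

HB.instance Definition _ T :=
  GRing.isLinear.Build K {mpoly K[n]} {mpoly K[n]} _ (tensor T)
    (tensor_is_linear T).

Lemma tensorX T m : tensor T 'X_[m] = \prod_i mop i (T i 'X^(m i)).
Proof. by rewrite /tensor msuppX big_seq1 mcoeffX eqxx scale1r. Qed.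

Lemma eq_tensor T T' f : (forall i, T i =1 T' i) -> tensor T f = tensor T' f.
Proof.
by move=> eqT; apply: eq_bigr => m _; under eq_bigr do rewrite eqT.
Qed.

Lemma tensor_id T f :
  (forall m i, m \in msupp f -> T i 'X^(m i) = 'X^(m i)) -> tensor T f = f.
Proof.
move=> Tid; rewrite [RHS]mpolyE; apply: eq_big_seq => m mf.
by rewrite mpolyXE_id; under eq_bigr do rewrite Tid// mpoly_of_polyXn.
Qed.

(** On a monomial of exponent [m], the factors of the variables other than [i] come out as [Q],
    leaving [T i ('X^(m i) * h)]. *)
Lemma tensor_mul_eq0 T i h f :
    linear (T i) -> (forall k, T i ('X^k * h) = 0) ->
  tensor T (mop i h * f) = 0.
Proof.
move=> linT Th0; pose T' := GRing.isLinear.Build _ _ _ _ _ linT.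
pose Ti : {linear {poly K} -> {poly K}} := HB.pack (T i) T'.
rewrite [f]mpolyE mulr_sumr linear_sum big1_seq // => m _.
rewrite -scalerAr linearZ /= -[RHS](scaler0 _ (f@_m)); congr (_ *: _).
rewrite mpoly_of_polyE mulr_suml linear_sum /=.
set Q := \prod_(j | j != i) mop j (T j 'X^(m j)).
under eq_bigr => k _.
  rewrite -scalerAl linearZ /= mpolyXn -mpolyXD tensorX (bigD1 i) //=.
  rewrite mnmDE mulmnE mnm1E eqxx mul1n.
  under eq_bigr => j ij.
    rewrite mnmDE mulmnE mnm1E eq_sym (negPf ij) mul0n add0n; over.
  rewrite -/Q; over.
have := Th0 (m i); rewrite -{1}[h]coefK poly_def mulr_sumr.
rewrite -[T i _]/(Ti _) linear_sum => /(congr1 (mop i)).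
rewrite /mpoly_of_poly raddf_sum raddf0 /= => Th.
under eq_bigr do rewrite scalerAl.
rewrite -mulr_suml (_ : \sum_(_ < _) _ = 0) ?mul0r ?scaler0//.
rewrite -[RHS]Th; apply: eq_bigr => k _.
rewrite -scalerAr -exprD addnC -[T i (_ *: _)]/(Ti (_ *: _)) linearZ /=.
by rewrite linearZ /= mulr_algl.
Qed.

Lemma tensor_expand (I : Type) (s : seq I) (c : I -> {poly K} -> K)
    (L : I -> {poly K}) T i f :
    (forall p, T i p = \sum_(x <- s) c x p *: L x) ->
  tensor T f = \sum_(x <- s) mop i (L x) *
    tensor (fun j => if j == i then fun p => (c x p)%:P else T j) f.
Proof.
move=> Ti; under [RHS]eq_bigr do rewrite mulr_sumr.
rewrite exchange_big; apply: eq_bigr => m _ /=.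
under [RHS]eq_bigr => x _ do rewrite -scalerAr (bigD1 i) //= eqxx mpoly_of_polyC
  mulrA [mop i _ * _]mulrC mul_mpolyC.
rewrite -scaler_sumr (bigD1 i) //= Ti /mpoly_of_poly raddf_sum /=.
rewrite mulr_suml; congr (_ *: _); apply: eq_bigr => x _.
rewrite linearZ /= mulr_algl; congr (_ * _).
by apply: eq_bigr => j /negPf ->.
Qed.

Lemma ltn_msize_in i m f : m \in msupp f -> (m i < msize_in i f)%N.
Proof. by move: m; apply/msize_in_leP. Qed.

Lemma msize_inM i (d e : nat) f g :
  (msize_in i f <= d)%N -> (msize_in i g <= e.+1)%N ->
  (msize_in i (f * g) <= d + e)%N.
Proof.
move=> /msize_in_leP fd /msize_in_leP ge; apply/msize_in_leP => m.
move=> /msuppM_le/allpairsP[[m1 m2] /= [/fd lt1 /ge lt2 ->]].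
by rewrite mnmDE; lia.
Qed.

Lemma msize_in_of_poly i p : (msize_in i (mop i p) <= size p)%N.
Proof.
rewrite mpoly_of_polyE; apply/msize_in_leP => m /msupp_sum_le.
move=> /flatten_mapP[k _ /msuppZ_le].
by rewrite mpolyXn msuppX inE => /eqP ->; rewrite mulmnE mnm1E eqxx mul1n.
Qed.

Lemma msize_in_of_poly_neq i j p : j != i -> (msize_in i (mop j p) <= 1)%N.
Proof.
move=> ji; rewrite mpoly_of_polyE; apply/msize_in_leP => m /msupp_sum_le.
move=> /flatten_mapP[k _ /msuppZ_le]; rewrite mpolyXn msuppX inE => /eqP ->.
by rewrite mulmnE mnm1E (negPf ji).
Qed.

Lemma msize_in_tensor T i (d : nat) f :
    (forall m, m \in msupp f -> (size (T i 'X^(m i)) <= d)%N) ->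
  (msize_in i (tensor T f) <= d)%N.
Proof.
move=> Td; apply/msize_in_leP => m; rewrite /tensor big_seq => /msupp_sum_le.
move=> /flatten_mapP[m']; rewrite mem_filter => /andP[/Td Tm' _] /msuppZ_le.
rewrite (bigD1 i) //=; set Q := \prod_(j | j != i) _.
suff /(msize_inM (leq_trans (msize_in_of_poly i _) Tm')) : (msize_in i Q <= 1)%N.
  by rewrite addn0 => /msize_in_leP; apply.
apply: (big_ind (fun f => msize_in i f <= 1)%N) => [|g1 g2|j ji].
- by apply/msize_in_leP => m''; rewrite msupp1 inE => /eqP->; rewrite mnm0E.
- by move=> g1_le /(msize_inM g1_le).
exact: msize_in_of_poly_neq.
Qed.

(** The values are constant polynomials, so that a functional can be a factor of [tensor]. *)
Definition jet (a : 'I_n -> K) (k : 'I_n -> nat) i p : {poly K} :=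
  (p^`(k i).[a i])%:P.

Lemma tensor_jet a m f : tensor (jet a m) f = (partial_at a m f)%:MP.
Proof.
rewrite /partial_at mderivmE (raddf_sum (meval a)) (raddf_sum (@mpolyC n K)).
apply: eq_bigr => m' _ /=.
rewrite mevalZ mevalX -mulrA mpolyCM mul_mpolyC; congr (_ *: _).
under eq_bigr do rewrite /jet mpoly_of_polyC derivnXn hornerMn hornerXn.
rewrite -rmorph_prod natr_prod -big_split /=; congr (_%:MP).
by apply: eq_bigr => i _; rewrite mnmBE mulr_natl.
Qed.

End CoordinatewiseOperators.

(** * Euclidean division in one variable *)

Section Division.
Context (K : fieldType) (n : nat) (i : 'I_n) (h : {poly K}).
Hypothesis h_neq0 : h != 0.
Implicit Types (p q r : {mpoly K[n]}).

Definition mod_at (j : 'I_n) (u : {poly K}) := if j == i then u %% h else u.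
Definition div_at (j : 'I_n) (u : {poly K}) := if j == i then u %/ h else u.

Lemma mpoly_of_poly_neq0 : mpoly_of_poly i h != 0.
Proof.
apply: contraNneq h_neq0 => h0; apply/eqP/polyP => k.
by rewrite coef0 -(mcoeff_mpoly_of_poly i) h0 mcoeff0.
Qed.

Lemma tensor_mod_mul q : tensor mod_at (mpoly_of_poly i h * q) = 0.
Proof.
apply: tensor_mul_eq0 => [c u v|k]; rewrite /mod_at eqxx ?modp_mull//.
by rewrite modpD modpZl.
Qed.

(** The operator kills the multiple of [h] and fixes [r], whose exponents in the variable [i] are
    below the degree of [h]. *)
Lemma is_edivp_in_tensor p q r : is_edivp_in i p h q r -> r = tensor mod_at p.
Proof.
move=> [-> r_lt]; rewrite linearD /= tensor_mod_mul add0r.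
rewrite tensor_id // => m j mr; rewrite /mod_at; case: eqP => // ->.
by rewrite modp_small// size_polyXn (leq_ltn_trans (ltn_msize_in i mr)).
Qed.

Lemma is_edivp_in_exists p :
  is_edivp_in i p h (tensor div_at p) (tensor mod_at p).
Proof.
split; last first.
  rewrite -(ltn_predK (_ : 0 < size h)%N) ?size_poly_gt0 ?h_neq0// ltnS.
  apply: msize_in_tensor => m _.
  by rewrite /mod_at eqxx -ltnS prednK ?size_poly_gt0// ltn_modp.
rewrite [LHS]mpolyE mulr_sumr -big_split; apply: eq_bigr => m _ /=.
rewrite -scalerAr -scalerDr; congr (_ *: _).
have D1 (F : 'I_n -> {mpoly K[n]}) :
    \prod_j F j = F i * \prod_(j | j != i) F j by rewrite (bigD1 i).
rewrite mpolyXE_id !D1; set Q := \prod_(j | j != i) _.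
have QE (T : 'I_n -> {poly K} -> {poly K}) :
    (forall j u, j != i -> T j u = u) ->
    \prod_(j | j != i) mpoly_of_poly j (T j 'X^(m j)) = Q.
  by move=> Tid; apply: eq_bigr => j ji; rewrite Tid // mpoly_of_polyXn.
rewrite (QE div_at) => [|j u /negPf ji]; last by rewrite /div_at ji.
rewrite (QE mod_at) => [|j u /negPf ji]; last by rewrite /mod_at ji.
rewrite /div_at /mod_at eqxx mulrA -mpoly_of_polyM.
rewrite -mulrDl -mpoly_of_polyXn; congr (_ * _).
rewrite {1}(divp_eq 'X^(m i) h) mulrC /mpoly_of_poly.
by rewrite rmorphD.
Qed.

Lemma is_edivp_in_unique p :
  exists! qr : {mpoly K[n]} * {mpoly K[n]}, is_edivp_in i p h qr.1 qr.2.
Proof.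
exists (tensor div_at p, tensor mod_at p); split; first exact: is_edivp_in_exists.
move=> [q r] /= E; have /= rE := is_edivp_in_tensor E; rewrite rE in E *.
congr (_, _); apply: (mulfI mpoly_of_poly_neq0); apply: (addIr (tensor mod_at p)).
by rewrite -E.1 -(is_edivp_in_exists p).1.
Qed.

Lemma msize_in_mod j (d : nat) p q r :
    j != i -> is_edivp_in i p h q r ->
  (msize_in j p <= d)%N -> (msize_in j r <= d)%N.
Proof.
move=> ji /is_edivp_in_tensor -> /msize_in_leP pd; apply: msize_in_tensor => m /pd.
by rewrite /mod_at (negPf ji) size_polyXn.
Qed.

End Division.

(** * Vanishing jets and uniqueness *)

Section Interpolation.
Context (K : fieldType) (n : nat) (A : 'I_n -> {fset K}) (nu : 'I_n -> K -> nat).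
Implicit Types (f g : {mpoly K[n]}) (i : 'I_n).
Local Notation H := (Hpoly A nu).

Lemma size_Hpoly i : size (H i) = (\sum_(a <- A i) nu i a).+1.
Proof.
rewrite /Hpoly; elim: (enum_fset (A i)) => [|a s IHs].
  by rewrite !big_nil size_poly1.
rewrite !big_cons size_monicM ?monic_exp ?monicXsubC//.
  by rewrite IHs size_exp_XsubC addSn addnS.
by rewrite -size_poly_gt0 IHs.
Qed.

Lemma Hpoly_neq0 i : H i != 0.
Proof. by rewrite -size_poly_gt0 size_Hpoly. Qed.

Lemma in_VspaceP f :
  reflect (forall i, msize_in i f < size (H i))%N (f \in Vspace A nu).
Proof.
by apply: (iffP forallP) => fV i; have := fV i; rewrite size_Hpoly ltnS.
Qed.

Hypothesis nu_gt0 : forall i (a : K), a \in A i -> (0 < nu i a)%N.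

Lemma in_boxP (a : 'I_n -> K) (m : 'X_{1..n}) : in_grid A a ->
  in_box nu a m <-> (forall i, m i < nu i (a i))%N.
Proof.
move=> aA; split=> am i; have := am i; have := nu_gt0 (aA i); lia.
Qed.

Lemma partial_at_mul_Hpoly a m i f : in_grid A a -> in_box nu a m ->
  partial_at a m (mpoly_of_poly i (H i) * f) = 0.
Proof.
move=> aA /(in_boxP _ aA) am; apply/eqP; rewrite -(@mpolyC_eq n).
rewrite -tensor_jet mpolyC0; apply/eqP/tensor_mul_eq0 => [c u v|k]; rewrite /jet.
  by rewrite derivnD derivnZ hornerD hornerZ polyCD polyCM mul_polyC.
rewrite (derivn_horner_eq0 (am i)) ?polyC0// dvdp_mull//.
by rewrite /Hpoly (bigD1_seq (a i)) ?fset_uniq ?aA //= dvdp_mulr.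
Qed.

(** Passes from total reduction at [t = 0] to a full jet at [t = n]. *)
Definition jet_mod (t : nat) (a : 'I_n -> K) (k : 'I_n -> nat) i (p : {poly K}) :=
  if (i < t)%N then jet a k i p else p %% H i.

(* Descending induction on [t]: [tensor_expand] writes stage [t] in terms of   *)
(* stage [t.+1], where variable [t] carries a jet instead of a remainder.      *)
Lemma tensor_jet_mod_eq0 (charK0 : [pchar K] =i pred0) f :
    (forall a m, in_grid A a -> in_box nu a m -> partial_at a m f = 0) ->
  forall (t : nat) (a : 'I_n -> K) (k : 'I_n -> nat), (t <= n)%N ->
    (forall i, (i < t)%N -> a i \in A i /\ (k i < nu i (a i))%N) ->
  tensor (jet_mod t a k) f = 0.
Proof.
move=> f0 t a k /subnK; move: (n - t)%N => d; elim: d t a k => [|d IHd] t a k.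
  rewrite add0n => -> aA; pose m := [multinom k i | i < n].
  rewrite (@eq_tensor _ _ _ (jet a m)) => [|i p]; last first.
    by rewrite /jet_mod ltn_ord /jet mnmE.
  have aG : in_grid A a by move=> i; case: (aA i).
  rewrite tensor_jet f0 ?mpolyC0//; apply/in_boxP => // i.
  by rewrite mnmE; case: (aA i).
move=> tdn aA; have tn : (t < n)%N by lia.
pose i := Ordinal tn.
have [L HL] := hermite_basis charK0 (nu i) (fset_uniq (A i)).
pose s := [seq (b, l) | b <- enum_fset (A i), l <- index_iota 0 (nu i b)].
(* [HL] is only a congruence; reducing [L] modulo [H i] makes it an equality. *)
have modE p : jet_mod t a k i p =
    \sum_(x <- s) p^`(x.2).[x.1] *: (L x.1 x.2 %% H i).
  rewrite /jet_mod ltnn big_allpairs_dep /=.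
  have /modp_eq0 Hp := HL p.
  rewrite -{1}[p](subrK (\sum_(b <- A i) \sum_(l < nu i b)
    p^`(l).[b] *: L b l)) modpD Hp add0r.
  rewrite (big_morph (fun q => q %% H i) (modpD _) (mod0p _)).
  apply: eq_bigr => b _; rewrite big_mkord.
  rewrite (big_morph (fun q => q %% H i) (modpD _) (mod0p _)).
  by apply: eq_bigr => l _; rewrite modpZl.
rewrite (tensor_expand _ modE) big1_seq // => x /= /allpairsPdep[b [l]].
rewrite mem_index_iota => -[bA /= lb ->] /=.
pose a' j := if j == i then b else a j.
pose k' j := if j == i then l else k j.
rewrite (@eq_tensor _ _ _ (jet_mod t.+1 a' k')) => [|j p].
  rewrite IHd ?mulr0// => [|j]; first by lia.
  rewrite ltnS leq_eqVlt /a' /k' -[j == t :> nat]/(j == i).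
  by case: (eqVneq j i) => [-> //|_ /= /aA].
rewrite /jet_mod /jet ltnS [(j <= t)%N]leq_eqVlt /a' /k' -val_eqE /=.
by case: eqP.
Qed.

Lemma Vspace_partial_at_eq0 (charK0 : [pchar K] =i pred0) f : f \in Vspace A nu ->
    (forall a m, in_grid A a -> in_box nu a m -> partial_at a m f = 0) ->
  f = 0.
Proof.
move=> /in_VspaceP fV /(tensor_jet_mod_eq0 charK0).
(* At stage 0 no variable carries a jet, so the node and orders are dummies. *)
move=> /(_ 0%N (fun=> 0) (fun=> 0%N) isT) <- //; apply/esym/tensor_id => m i mf.
rewrite /jet_mod modp_small // size_polyXn.
exact: leq_ltn_trans (ltn_msize_in i mf) (fV i).
Qed.

End Interpolation.

Theorem proposition4p5 (K : fieldType) (charK0 : [pchar K] =i pred0) (n : nat)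
    (A : 'I_n -> {fset K}) (nu : 'I_n -> K -> nat)
    (nu_gt0 : forall (i : 'I_n) (a : K), a \in A i -> (0 < nu i a)%N)
    (g : {mpoly K[n]}) :
  (forall (i : 'I_n) (p : {mpoly K[n]}),
     exists! qr : {mpoly K[n]} * {mpoly K[n]},
       is_edivp_in i p (Hpoly A nu i) qr.1 qr.2) /\
  (forall (q : 'I_n -> {mpoly K[n]}) (r : nat -> {mpoly K[n]}),
     r 0%N = g ->
     (forall i : 'I_n, is_edivp_in i (r i) (Hpoly A nu i) (q i) (r i.+1)) ->
     exists f : {mpoly K[n]},
       [/\ unique (interpolates A nu g) f,
           f = r n
         & g - f = \sum_(i < n) mpoly_of_poly i (Hpoly A nu i) * q i]).
Proof.
split=> [i p|q r r0 rE]; first exact/is_edivp_in_unique/Hpoly_neq0.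
(* Later divisions preserve the degree bounds already gained. *)
have rV (t : nat) : (t <= n)%N ->
    forall i : 'I_n, (i < t)%N -> (msize_in i (r t) < size (Hpoly A nu i))%N.
  elim: t => [//|t IHt] tn i; have E := rE (Ordinal tn).
  rewrite ltnS leq_eqVlt -[i == t :> nat]/(i == Ordinal tn).
  case: (eqVneq i (Ordinal tn)) => [-> _|it /= i_t]; first exact: E.2.
  rewrite size_Hpoly ltnS.
  apply: (msize_in_mod it E); rewrite -ltnS -size_Hpoly; exact/IHt/i_t/ltnW.
have gE : g - r n = \sum_(i < n) mpoly_of_poly i (Hpoly A nu i) * q i.
  rewrite -r0 -opprB -(telescope_sumr r (leq0n n)) big_mkord -sumrN.
  apply: eq_bigr => i _; rewrite (rE i).1; ring.
have r_interp : interpolates A nu g (r n).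
  split=> [|a m aA am]; first by apply/in_VspaceP => i; apply: rV.
  (* The jets of g - r_n vanish, each summand being a multiple of some H_i. *)
  rewrite -[g](subrK (r n)) gE /partial_at mderivmD mevalD.
  rewrite -[LHS]add0r; congr (_ + _); rewrite !raddf_sum /= big1 // => i _.
  exact: partial_at_mul_Hpoly.
exists (r n); split=> //; split=> // f [fV f_interp].
apply/eqP; rewrite -subr_eq0; apply/eqP.
apply: (Vspace_partial_at_eq0 nu_gt0 charK0) => [|a m aA am].
  by rewrite rpredB// r_interp.1.
rewrite /partial_at mderivmB mevalB -!/(partial_at _ _ _).
by rewrite f_interp// r_interp.2// subrr.
Qed.
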